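(* There is an algorithm which, given a finite forest algebra $(H,V)$ (by its finite operation tables), decides whether $(H,V)$ is 2-distributive.
   Context: A forest algebra is a pair $(H,V)$ where $H$ is a monoid written additively (neutral element $0_H$), $V$ is a monoid written multiplicatively, and $V$ acts faithfully on $H$. For every $h$ there is $I_h\in V$ with $I_h h'=h+h'$, and every $h\in H$ equals $v\cdot 0_H$ for some $v\in V$. All forest algebras are assumed horizontally commutative and idempotent ($h_1+h_2=h_2+h_1$, $h+h=h$). Morphisms preserve all of this structure. The free forest algebra $\Sigma^\Delta=(H_\Sigma,V_\Sigma)$ over a finite alphabet $\Sigma$ consists of forests and contexts. Trees are $\alpha[C]$ with $\alpha\in\Sigma$ and $C$ a finite set of trees; forests are finite sets of trees under union. Contexts are forests with one leaf replaced by a hole, composed and acting by substitution. For a forest $f$, $\pi(f)\subseteq\Sigma^*$ denotes the prefix-closed set of (not necessarily maximal) root-starting label paths of $f$. $(H,V)$ is 2-distributive if for every finite alphabet $\Sigma$, every morphism $\phi:\Sigma^\Delta\to(H,V)$, every context $v\in V_\Sigma$, and all forests $f_1,f_2$ with $\pi(f_1)=\pi(f_2)$, we have $\phi(v(f_1+f_2))=\phi(vf_1+vf_2)$. *)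

(* Defs.v *)
From mathcomp Require Import all_boot.
From Stdlib Require List.
Set Implicit Arguments. Unset Strict Implicit. Unset Printing Implicit Defensive.

(*    The existence of an algorithm is rendered as the existence of a   *)
(*    mu-recursive program (Church-Turing thesis).                     *)

Inductive prog : Type :=
| PZero
| PSucc
| PProj (i : nat)
| PComp (f : prog) (gs : seq prog)
| PPrec (g h : prog)
| PMu (f : prog).

Inductive ev : prog -> seq nat -> nat -> Prop :=
| evZero xs : ev PZero xs 0
| evSucc x xs : ev PSucc (x :: xs) x.+1
| evProj i xs : i < size xs -> ev (PProj i) xs (nth 0 xs i)
| evComp f gs xs ys y : evs gs xs ys -> ev f ys y -> ev (PComp f gs) xs y
| evPrec0 g h xs y : ev g xs y -> ev (PPrec g h) (0 :: xs) y
| evPrecS g h n xs r y :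
    ev (PPrec g h) (n :: xs) r -> ev h (n :: r :: xs) y ->
    ev (PPrec g h) (n.+1 :: xs) y
| evMu f xs n :
    ev f (n :: xs) 0 ->
    (forall m, m < n -> exists v, ev f (m :: xs) v.+1) ->
    ev (PMu f) xs n
with evs : seq prog -> seq nat -> seq nat -> Prop :=
| evsNil xs : evs [::] xs [::]
| evsCons g gs xs y ys : ev g xs y -> evs gs xs ys -> evs (g :: gs) xs (y :: ys).

Definition cpair (a b : nat) : nat := ((a + b) * (a + b).+1) %/ 2 + b.

Fixpoint code_list (l : seq nat) : nat :=
  match l with
  | [::] => 0
  | x :: l' => (cpair x (code_list l')).+1
  end.

(*    H = {0,...,nH-1}, V = {0,...,nV-1}.                              *)

Record ffa : Type := FFA {
  nH : nat;
  nV : nat;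
  zeroH : nat;
  oneV : nat;
  addH : nat -> nat -> nat;
  mulV : nat -> nat -> nat;
  actV : nat -> nat -> nat
}.

Definition table (m n : nat) (f : nat -> nat -> nat) : seq nat :=
  flatten [seq [seq f i j | j <- iota 0 n] | i <- iota 0 m].

Definition ffa_enc (A : ffa) : seq nat :=
  [:: nH A; nV A; zeroH A; oneV A]
  ++ table (nH A) (nH A) (addH A)
  ++ table (nV A) (nV A) (mulV A)
  ++ table (nV A) (nH A) (actV A).

Definition ffa_code (A : ffa) : nat := code_list (ffa_enc A).

Definition is_forest_algebra (A : ffa) : Prop :=
  let inH h := h < nH A in
  let inV v := v < nV A in
  inH (zeroH A) /\ inV (oneV A) /\
      (forall h h', inH h -> inH h' -> inH (addH A h h')) /\
      (forall v w, inV v -> inV w -> inV (mulV A v w)) /\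
      (forall v h, inV v -> inH h -> inH (actV A v h)) /\
      (forall h1 h2 h3, inH h1 -> inH h2 -> inH h3 ->
          addH A h1 (addH A h2 h3) = addH A (addH A h1 h2) h3) /\
      (forall h, inH h -> addH A (zeroH A) h = h /\ addH A h (zeroH A) = h) /\
      (forall h1 h2, inH h1 -> inH h2 -> addH A h1 h2 = addH A h2 h1) /\
      (forall h, inH h -> addH A h h = h) /\
      (forall v1 v2 v3, inV v1 -> inV v2 -> inV v3 ->
          mulV A v1 (mulV A v2 v3) = mulV A (mulV A v1 v2) v3) /\
      (forall v, inV v -> mulV A (oneV A) v = v /\ mulV A v (oneV A) = v) /\
      (forall v w h, inV v -> inV w -> inH h ->
          actV A (mulV A v w) h = actV A v (actV A w h)) /\
      (forall h, inH h -> actV A (oneV A) h = h) /\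
      (forall v w, inV v -> inV w ->
          (forall h, inH h -> actV A v h = actV A w h) -> v = w) /\
      (forall h, inH h -> exists2 I, inV I &
          forall h', inH h' -> actV A I h' = addH A h h') /\
      (forall h, inH h -> exists2 v, inV v & actV A v (zeroH A) = h).

(*    Forests are represented by lists of trees; since all forest      *)
(*    algebras are horizontally commutative and idempotent, every      *)
(*    morphism factors through the set of trees of the list.           *)

Inductive tree (S : Type) : Type := Node : S -> seq (tree S) -> tree S.
Arguments Node {S}.

Definition forest (S : Type) := seq (tree S).

Definition label S (t : tree S) : S := let: Node a _ := t in a.
Definition children S (t : tree S) : forest S := let: Node _ c := t in c.

Inductive context (S : Type) : Type :=
| Hole : context S
| CPlus : forest S -> context S -> context S
| CNode : S -> context S -> context S.
Arguments Hole {S}.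

Fixpoint subst S (c : context S) (f : forest S) : forest S :=
  match c with
  | Hole => f
  | CPlus g c' => g ++ subst c' f
  | CNode a c' => [:: Node a (subst c' f)]
  end.

Fixpoint in_pi S (f : forest S) (w : seq S) : Prop :=
  match w with
  | [::] => True
  | a :: w' => exists2 t, List.In t f & label t = a /\ in_pi (children t) w'
  end.

Definition same_paths S (f1 f2 : forest S) : Prop :=
  forall w, in_pi f1 w <-> in_pi f2 w.

(* The forest component of the unique morphism Sigma^Delta -> A sending
   the generator context a[hole] to g a. *)
Fixpoint eval_tree S (A : ffa) (g : S -> nat) (t : tree S) : nat :=
  let: Node a c := t in
  actV A (g a)
    ((fix ef (l : seq (tree S)) : nat :=
        match l with
        | [::] => zeroH A
        | t' :: l' => addH A (eval_tree A g t') (ef l')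
        end) c).

Definition eval_forest S (A : ffa) (g : S -> nat) (f : forest S) : nat :=
  foldr (fun t acc => addH A (eval_tree A g t) acc) (zeroH A) f.

Definition two_distributive (A : ffa) : Prop :=
  forall (Sigma : finType) (g : Sigma -> nat),
    (forall a, g a < nV A) ->
    forall (v : context Sigma) (f1 f2 : forest Sigma),
      same_paths f1 f2 ->
      eval_forest A g (subst v (f1 ++ f2)) =
      eval_forest A g (subst v f1 ++ subst v f2).

(* Main.v *)
Require Import Defs.
From mathcomp Require Import all_boot zify.
From Stdlib Require Import Classical.
Set Implicit Arguments. Unset Strict Implicit. Unset Printing Implicit Defensive.

(** Every context acts as an element of V, so 2-distributivity says that each v
    in V satisfies v(h1 + h2) = v h1 + v h2 whenever h1, h2 are values of
    forests with the same paths.  For a forest f, let U(f) be the set of value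
    sets {phi(C_1), ..., phi(C_k)} of the nonempty finite families of forests
    whose union has the same paths as f; then h1, h2 are such values iff {h1}
    and {h2} belong to a common U(f).  Passing from single forests to families
    makes U compositional: if the letter a does not occur at the roots of f,
    then U(f + a[f']) is a function of a, U(f) and U(f').  Hence
    2-distributivity holds iff some set s of sets of subsets of H contains
    U(0), is closed under this function, and has only members satisfying the
    required equations.  Repeating a letter only yields subsets of some U(f),
    which is harmless, so s need not keep track of the letters used.  As H is
    finite, s ranges over a finite set, and everything is a formula with
    bounded quantifiers, hence primitive recursive. *)

(** * Closure properties of computable functions *)

(** The list is an environment: a formula is a function of one list, and each bound variable is put
    in front of it, in the manner of de Bruijn indices. *)
Definition computes (k : nat) (f : seq nat -> nat) : Prop :=
  exists p, forall e, size e = k -> ev p e (f e).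

Definition computesb (k : nat) (P : seq nat -> bool) : Prop :=
  computes k (fun e => P e).

(** Substitutions between environments, which let a known function be used under further binders. *)
Definition env_map (m k : nat) (r : seq nat -> seq nat) : Prop :=
  exists ps, forall e, size e = k -> size (r e) = m /\ evs ps e (r e).

Lemma computes_ext k f h : f =1 h -> computes k f -> computes k h.
Proof. by move=> fh [p Hp]; exists p => e He; rewrite -fh; exact: Hp. Qed.

Lemma computesb_ext k P Q : P =1 Q -> computesb k P -> computesb k Q.
Proof. by move=> PQ; apply: computes_ext => e; rewrite PQ. Qed.

Lemma computes_comp m k x r :
  computes m x -> env_map m k r -> computes k (fun e => x (r e)).
Proof.
move=> [p Hp] [ps Hps]; exists (PComp p ps) => e He.
by have [Hr evr] := Hps e He; apply: evComp evr _; apply: Hp.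
Qed.

Lemma env_map_id k : env_map k k (fun e => e).
Proof.
exists [seq PProj i | i <- iota 0 k] => e He; split=> //.
rewrite -{2}[e](mkseq_nth 0) /mkseq He.
have : {subset iota 0 k <= gtn (size e)}.
  by move=> i; rewrite mem_iota He => /andP[].
elim: (iota 0 k) => [|i s IHs] sub /=; first exact: evsNil.
apply: evsCons; first by apply: evProj; apply: sub; rewrite inE eqxx.
by apply: IHs => j js; apply: sub; rewrite inE js orbT.
Qed.

Lemma env_map_behead m k r :
  env_map m.+1 k r -> env_map m k (fun e => behead (r e)).
Proof.
case=> ps Hps; exists (behead ps) => e He; have [Hr evr] := Hps e He.
by split; [rewrite size_behead Hr | case: evr Hr].
Qed.

Lemma env_map_cons m k a r :
  computes k a -> env_map m k r -> env_map m.+1 k (fun e => a e :: r e).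
Proof.
case=> p Hp [ps Hps]; exists (p :: ps) => e He; have [Hr evr] := Hps e He.
by split; [rewrite /= Hr | apply: evsCons evr; apply: Hp].
Qed.

Lemma computes_head m k r :
  env_map m.+1 k r -> computes k (fun e => head 0 (r e)).
Proof.
apply: computes_comp; exists (PProj 0) => -[|a e] // _.
exact: (@evProj 0 (a :: e)).
Qed.

Lemma computes_const k n : computes k (fun=> n).
Proof.
elim: n => [|n [p Hp]]; first by exists PZero => e _; exact: evZero.
exists (PComp PSucc [:: p]) => e He.
apply: (evComp (ys := [:: n])); last exact: evSucc.
by apply: evsCons; [exact: Hp | exact: evsNil].
Qed.

Lemma computes_succ k a : computes k a -> computes k (fun e => (a e).+1).
Proof.
case=> p Hp; exists (PComp PSucc [:: p]) => e He.
apply: (evComp (ys := [:: a e])); last exact: evSucc.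
by apply: evsCons; [exact: Hp | exact: evsNil].
Qed.

(** The step reads the counter and the accumulator as the two innermost variables, in the order in
    which [PPrec] passes them. Bounded loops, quantifiers and searches all reduce to this case. *)
Lemma computes_iteri k n b (s : nat -> nat -> seq nat -> nat) :
  computes k n -> computes k b ->
  computes k.+2 (fun e => s (head 0 e) (head 0 (behead e)) (behead (behead e))) ->
  computes k (fun e => iteri (n e) (fun i r => s i r e) (b e)).
Proof.
case=> pn Hn [pb Hb] [ps Hs].
have [qs Hqs] := env_map_id k.
exists (PComp (PPrec pb ps) (pn :: qs)) => e He.
apply: (evComp (ys := n e :: e)).
  by apply: evsCons; [exact: Hn | case: (Hqs e He)].
elim: (n e) => [|m IHm] /=; first by apply: evPrec0; exact: Hb.
apply: evPrecS; first exact: IHm.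
by apply: (Hs [:: m, iteri m (fun i r => s i r e) (b e) & e]); rewrite /= He.
Qed.

Lemma computes_nat_of_bool k P : computesb k P -> computes k (fun e => P e).
Proof. by []. Qed.

Ltac computability_var :=
  cbv beta;
  match goal with
  | |- computes _ (fun _ => ?n) => exact: computes_const
  | H : computes ?m ?c |- computes _ ?c => exact: H
  | H : computesb ?m ?c |- computesb _ ?c => exact: H
  | H : computes ?m ?c |- computes _ (fun e => ?c (@?r e)) =>
      refine (computes_comp H (_ : env_map m _ r))
  | H : computesb ?m ?c |- computesb _ (fun e => ?c (@?r e)) =>
      refine (computes_comp H (_ : env_map m _ r))
  | |- computes _ (head 0) => refine (computes_head (@env_map_id _))
  | |- computes _ (fun e => head 0 (@?r e)) =>
      refine (@computes_head _ _ r _)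
  end;
  repeat match goal with
  | |- env_map _ _ (fun e => e) => exact: env_map_id
  | |- env_map _ _ behead => refine (env_map_behead (@env_map_id _))
  | |- env_map _ _ (fun e => behead (@?r e)) =>
      refine (@env_map_behead _ _ r _)
  end.

Create HintDb computability.
#[local] Hint Extern 0 (computes _ _) => computability_var : computability.
#[local] Hint Extern 0 (computesb _ _) => computability_var : computability.
#[local] Hint Resolve computes_succ computes_iteri computes_nat_of_bool
  : computability.
Ltac computability := solve [cbv beta; auto 40 with computability nocore].

Lemma computes_add k a b :
  computes k a -> computes k b -> computes k (fun e => a e + b e).
Proof.
move=> Ha Hb.
apply: (@computes_ext _ (fun e => iteri (b e) (fun _ r => r.+1) (a e))) => [e|].
  by elim: (b e) => [|n /= ->]; rewrite ?addn0 ?addnS.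
computability.
Qed.
#[local] Hint Resolve computes_add : computability.

Lemma computes_pred k a : computes k a -> computes k (fun e => (a e).-1).
Proof.
move=> Ha.
apply: (@computes_ext _ (fun e => iteri (a e) (fun i _ => i) 0)) => [e|].
  by case: (a e).
computability.
Qed.
#[local] Hint Resolve computes_pred : computability.

Lemma computes_sub k a b :
  computes k a -> computes k b -> computes k (fun e => a e - b e).
Proof.
move=> Ha Hb.
apply: (@computes_ext _ (fun e => iteri (b e) (fun _ r => r.-1) (a e))) => [e|].
  by elim: (b e) => [|n /= ->]; rewrite ?subn0 ?subnS.
computability.
Qed.
#[local] Hint Resolve computes_sub : computability.

Lemma computes_mul k a b :
  computes k a -> computes k b -> computes k (fun e => a e * b e).
Proof.
move=> Ha Hb.
apply: (@computes_ext _ (fun e => iteri (b e) (fun _ r => a e + r) 0)) => [e|].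
  by elim: (b e) => [|n /= ->]; rewrite ?muln0 ?mulnS.
computability.
Qed.
#[local] Hint Resolve computes_mul : computability.

Lemma computes_exp k a b :
  computes k a -> computes k b -> computes k (fun e => a e ^ b e).
Proof.
move=> Ha Hb.
apply: (@computes_ext _ (fun e => iteri (b e) (fun _ r => a e * r) 1)) => [e|].
  by elim: (b e) => [|n /= ->]; rewrite ?expn0 ?expnS.
computability.
Qed.
#[local] Hint Resolve computes_exp : computability.

Lemma computes_if k P a b :
  computesb k P -> computes k a -> computes k b ->
  computes k (fun e => if P e then a e else b e).
Proof.
move=> HP Ha Hb.
apply: (@computes_ext _ (fun e => iteri (P e) (fun _ _ => a e) (b e))) => [e|].
  by case: (P e).
computability.
Qed.
#[local] Hint Resolve computes_if : computability.

Lemma computesb_not k P : computesb k P -> computesb k (fun e => ~~ P e).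
Proof.
move=> HP.
apply: (@computes_ext _ (fun e => if P e then 0 else 1)) => [e|].
  by case: (P e).
computability.
Qed.
#[local] Hint Resolve computesb_not : computability.

Lemma computesb_and k P Q :
  computesb k P -> computesb k Q -> computesb k (fun e => P e && Q e).
Proof.
move=> HP HQ.
apply: (@computes_ext _ (fun e => if P e then nat_of_bool (Q e) else 0)) => [e|].
  by case: (P e).
computability.
Qed.
#[local] Hint Resolve computesb_and : computability.

Lemma computesb_imply k P Q :
  computesb k P -> computesb k Q -> computesb k (fun e => P e ==> Q e).
Proof.
move=> HP HQ.
apply: (@computes_ext _ (fun e => if P e then nat_of_bool (Q e) else 1)) => [e|].
  by case: (P e).
computability.
Qed.
#[local] Hint Resolve computesb_imply : computability.

Lemma computesb_eqn k a b :
  computes k a -> computes k b -> computesb k (fun e => a e == b e).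
Proof.
move=> Ha Hb.
apply: (@computes_ext _ (fun e => 1 - ((a e - b e) + (b e - a e)))) => [e|].
  by case: eqP => /=; lia.
computability.
Qed.
#[local] Hint Resolve computesb_eqn : computability.

Lemma computesb_eqb k P Q :
  computesb k P -> computesb k Q -> computesb k (fun e => P e == Q e).
Proof.
move=> HP HQ.
apply: (@computesb_ext _ (fun e => nat_of_bool (P e) == Q e)) => [e|].
  by case: (P e); case: (Q e).
computability.
Qed.
#[local] Hint Resolve computesb_eqb : computability.

Definition ball (n : nat) (P : pred nat) : bool := all P (iota 0 n).
Definition bex (n : nat) (P : pred nat) : bool := has P (iota 0 n).

Lemma ballP n (P : pred nat) : reflect (forall i, i < n -> P i) (ball n P).
Proof.
by apply: (iffP allP) => H i; [move=> lt_in; apply: H | move=> Hi; apply: H];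
  move: Hi || idtac; rewrite mem_iota // => /andP[].
Qed.

Lemma bexP n (P : pred nat) : reflect (exists2 i, i < n & P i) (bex n P).
Proof.
by apply: (iffP hasP) => -[i Hi Pi]; exists i => //; move: Hi; rewrite mem_iota.
Qed.

Lemma computesb_ball k n (P : nat -> seq nat -> bool) :
  computes k n -> computesb k.+1 (fun e => P (head 0 e) (behead e)) ->
  computesb k (fun e => ball (n e) (fun i => P i e)).
Proof.
move=> Hn HP.
apply: (@computes_ext _
    (fun e => iteri (n e) (fun i r => if P i e then r else 0) 1)) => [e|].
  elim: (n e) => [|m /= ->]; first by [].
  by rewrite /ball -addn1 iotaD all_cat /= andbT andbC; case: (P m e).
apply: computes_iteri; [by [] | computability |].
apply: computes_if; [|computability|computability].
(* The loop body sees counter and accumulator, while [P] expects the counter only, so the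
   accumulator is dropped. *)
apply: (computes_comp HP (r := fun e => head 0 e :: behead (behead e))).
apply: env_map_cons; first by computability.
by do 2!apply: env_map_behead; apply: env_map_id.
Qed.

Lemma computesb_bex k n (P : nat -> seq nat -> bool) :
  computes k n -> computesb k.+1 (fun e => P (head 0 e) (behead e)) ->
  computesb k (fun e => bex (n e) (fun i => P i e)).
Proof.
move=> Hn HP.
apply: (@computesb_ext _ (fun e => ~~ ball (n e) (fun i => ~~ P i e))) => [e|].
  by rewrite /ball /bex -has_predC; apply: eq_has => i /=; rewrite negbK.
apply: computesb_not; apply: computesb_ball; first by [].
exact: computesb_not.
Qed.
#[local] Hint Resolve computesb_ball computesb_bex : computability.

Lemma computes_iter k n b (s : nat -> seq nat -> nat) :
  computes k n -> computes k b ->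
  computes k.+1 (fun e => s (head 0 e) (behead e)) ->
  computes k (fun e => iter (n e) (fun r => s r e) (b e)).
Proof.
move=> Hn Hb Hs.
apply: (@computes_ext _ (fun e => iteri (n e) (fun _ r => s r e) (b e))) => [e|].
  by elim: (n e) => //= m ->.
apply: computes_iteri => //.
apply: (computes_comp Hs (r := behead)).
exact: env_map_behead (@env_map_id _).
Qed.
#[local] Hint Resolve computes_iter : computability.

Lemma computesb_odd k a : computes k a -> computesb k (fun e => odd (a e)).
Proof.
move=> Ha.
apply: (@computes_ext _ (fun e => iter (a e) (fun r => 1 - r) 0)) => [e|].
  by elim: (a e) => //= m ->; case: (odd m).
computability.
Qed.
#[local] Hint Resolve computesb_odd : computability.

Lemma computes_half k a : computes k a -> computes k (fun e => (a e)./2).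
Proof.
move=> Ha.
(* Half of n is the number of odd i < n. *)
apply: (@computes_ext _ (fun e => iteri (a e) (fun i r => odd i + r) 0)) => [e|].
  by elim: (a e) => //= m ->; rewrite uphalf_half.
computability.
Qed.
#[local] Hint Resolve computes_half : computability.

(** * Codes of pairs, lists, finite sets and algebras *)

Lemma computes_cpair k a b :
  computes k a -> computes k b -> computes k (fun e => cpair (a e) (b e)).
Proof.
move=> Ha Hb.
apply: (@computes_ext _
    (fun e => ((a e + b e) * (a e + b e).+1)./2 + b e)) => [e|].
  by rewrite /cpair divn2.
computability.
Qed.
#[local] Hint Resolve computes_cpair : computability.

(** Inversion by bounded search: both components of a pair are at most its code, and injectivity
    leaves a single hit. *)
Definition unpair1 c :=
  iteri c.+1 (fun i r => if bex c.+1 (fun b => cpair i b == c) then i else r) 0.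
Definition unpair2 c :=
  iteri c.+1 (fun i r => if bex c.+1 (fun a => cpair a i == c) then i else r) 0.

Lemma computes_unpair1 k c : computes k c -> computes k (fun e => unpair1 (c e)).
Proof. move=> Hc; rewrite /unpair1; computability. Qed.
Lemma computes_unpair2 k c : computes k c -> computes k (fun e => unpair2 (c e)).
Proof. move=> Hc; rewrite /unpair2; computability. Qed.
#[local] Hint Resolve computes_unpair1 computes_unpair2 : computability.

Lemma iteri_find n (P : pred nat) a :
  a < n -> P a -> (forall i, P i -> i = a) ->
  iteri n (fun i r => if P i then i else r) 0 = a.
Proof.
move=> + Pa Pu; elim: n => // n IHn; rewrite ltnS leq_eqVlt /= => /orP[/eqP<-|lt_an].
  by rewrite Pa.
by rewrite IHn //; case: ifP => // /Pu.
Qed.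

Lemma cpairE a b : cpair a b = 'C((a + b).+1, 2) + b.
Proof. by rewrite /cpair bin2 divn2 mulnC. Qed.

(** Pairs of sum s have codes from 'C(s.+1, 2) to 'C(s.+1, 2) + s, and the next sum starts at
    'C(s.+2, 2) = 'C(s.+1, 2) + s + 1. *)
Lemma cpair_lt_sum a b a' b' : a + b < a' + b' -> cpair a b < cpair a' b'.
Proof.
move=> lt_s; rewrite !cpairE.
have := leq_bin2l 2 (lt_s : (a + b).+2 <= (a' + b').+1).
by rewrite [in X in X <= _]binS bin1; lia.
Qed.

Lemma cpair_inj a b a' b' : cpair a b = cpair a' b' -> a = a' /\ b = b'.
Proof.
move=> eq_c; have [lt_s|lt_s|eq_s] := ltngtP (a + b) (a' + b').
- by have := cpair_lt_sum lt_s; rewrite eq_c ltnn.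
- by have := cpair_lt_sum lt_s; rewrite eq_c ltnn.
by move: eq_c; rewrite !cpairE eq_s; lia.
Qed.

Lemma leq_cpair a b : (a <= cpair a b) && (b <= cpair a b).
Proof. by rewrite cpairE binS bin1; lia. Qed.

Lemma unpair1K a b : unpair1 (cpair a b) = a.
Proof.
have /andP[le_a le_b] := leq_cpair a b.
apply: (iteri_find (P := fun i => bex _ (fun j => cpair i j == _))) => //.
  by apply/bexP; exists b.
by move=> i /bexP[j _ /eqP/cpair_inj[]].
Qed.

Lemma unpair2K a b : unpair2 (cpair a b) = b.
Proof.
have /andP[le_a le_b] := leq_cpair a b.
apply: (iteri_find (P := fun i => bex _ (fun j => cpair j i == _))) => //.
  by apply/bexP; exists a.
by move=> i /bexP[j _ /eqP/cpair_inj[]].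
Qed.

Definition code_nth c i := unpair1 (iter i (fun d => unpair2 d.-1) c).-1.

(** Past the end the iteration stays at 0, which codes both the empty list and the pair (0, 0); this
    produces the default value of [nth]. *)
Lemma code_nthE l i : code_nth (code_list l) i = nth 0 l i.
Proof.
elim: i l => [|i IHi] [|x l] //=; rewrite /code_nth ?iterSr /= ?unpair1K //.
  by rewrite -/(code_nth 0 i) (IHi [::]) nth_nil.
by rewrite unpair2K; apply: IHi.
Qed.

Lemma computes_code_nth k c i :
  computes k c -> computes k i -> computes k (fun e => code_nth (c e) (i e)).
Proof. move=> Hc Hi; rewrite /code_nth; computability. Qed.
#[local] Hint Resolve computes_code_nth : computability.

Definition bit x i := odd (iter i half x).

Lemma computesb_bit k x i :
  computes k x -> computes k i -> computesb k (fun e => bit (x e) (i e)).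
Proof. move=> Hx Hi; rewrite /bit; computability. Qed.
#[local] Hint Resolve computesb_bit : computability.

(** Comprehension for coded sets. It is applied to undecided properties such as being realized by
    some forest, hence the classical case split; only the correctness proof relies on it, not the
    program. *)
Lemma bits_exist n (P : nat -> Prop) :
  exists2 x, x < 2 ^ n & forall i, i < n -> (bit x i <-> P i).
Proof.
elim: n P => [|n IHn] P; first by exists 0.
have [x lt_x Hx] := IHn (fun i => P i.+1).
have [b Hb] : exists b : bool, b <-> P 0.
  by case: (classic (P 0)) => HP; [exists true | exists false].
exists (b + x.*2); first by rewrite expnS; case: (b); lia.
case=> [_|i lt_i]; rewrite /bit ?iterSr /=.
  by rewrite oddD odd_double addbF oddb.
by rewrite half_bit_double; apply: Hx.
Qed.

Lemma size_table m n f : size (table m n f) = m * n.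
Proof. by rewrite size_allpairs !size_iota. Qed.

Lemma nth_table m n f i j :
  i < m -> j < n -> nth 0 (table m n f) (i * n + j) = f i j.
Proof.
move=> + lt_j; rewrite /table; set row := fun i => _.
suff gen k : i < m ->
    nth 0 (flatten [seq row i | i <- iota k m]) (i * n + j) = f (k + i) j.
  exact: gen.
elim: m k i => //= m IHm k [|i] lt_i; rewrite nth_cat size_map size_iota.
  by rewrite lt_j (nth_map 0) ?size_iota // nth_iota // addn0.
by rewrite mulSn -addnA ltnNge leq_addr /= addKn IHm // addSnnS.
Qed.

(** The offsets follow [ffa_enc]: four header entries, then the three tables row by row. *)
Definition decode c : ffa :=
  let h := code_nth c 0 in let v := code_nth c 1 in
  FFA h v (code_nth c 2) (code_nth c 3)
    (fun i j => code_nth c (4 + (i * h + j)))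
    (fun i j => code_nth c (4 + (h * h + (i * v + j))))
    (fun i j => code_nth c (4 + (h * h + (v * v + (i * h + j))))).

(** The code records the operations on the carriers only, so the decoded algebra need not equal [A];
    agreement in range is carried over to values of forests by [transfer_eval]. *)
Lemma decode_code A :
  [/\ nH (decode (ffa_code A)) = nH A, nV (decode (ffa_code A)) = nV A,
    zeroH (decode (ffa_code A)) = zeroH A,
    forall i j, i < nH A -> j < nH A ->
      addH (decode (ffa_code A)) i j = addH A i j &
    forall v h, v < nV A -> h < nH A ->
      actV (decode (ffa_code A)) v h = actV A v h].
Proof.
have nthE i : code_nth (ffa_code A) i = nth 0 (ffa_enc A) i.
  exact: code_nthE.
rewrite /decode !nthE; split=> // i j lt_i lt_j; rewrite /= nthE /= nth_cat.
  by rewrite size_table ifT ?nth_table //; nia.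
rewrite add0n size_table ltnNge leq_addr /= addKn.
by rewrite nth_cat size_table ltnNge leq_addr /= addKn nth_table.
Qed.

(** * The decision procedure *)

(* A set of numbers is coded by the number whose binary digits form its
   characteristic function: codes of subsets of H are below [nsets A], codes of
   sets of subsets of H are below [nfams A]. *)
Definition nsets A := 2 ^ nH A.
Definition nfams A := 2 ^ nsets A.

Definition is_single A x h := ball (nH A) (fun i => bit x i == (i == h)).

(** The value of the forest of trees a[D], D running through a family with value set [z]; by
    idempotence only the set of values matters. *)
Definition act_sum A a z :=
  iteri (nH A) (fun i r => if bit z i then addH A (actV A a i) r else r)
    (zeroH A).

(* [x'] and [y] are the value sets of families [Cs] and [Ds]; [h] is the value
   of the forest made of a member of [Cs] of value [h'] and of the trees a[D]
   for the members D of [Ds] whose value lies in [z]. *)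
Definition link A a x' y x h' z h :=
  [&& bit x h, bit x' h', ball (nH A) (fun i => bit z i ==> bit y i)
    & h == addH A h' (act_sum A a z)].

(* [x] is the value set of a family of such forests in which every member of
   [Cs] and every member of [Ds] is used. *)
Definition graft A a x' y x :=
  [&& ball (nH A) (fun h => bit x h ==>
        bex (nH A) (fun h' => bex (nsets A) (fun z => link A a x' y x h' z h))),
      ball (nH A) (fun h' => bit x' h' ==>
        bex (nH A) (fun h => bex (nsets A) (fun z => link A a x' y x h' z h)))
    & ball (nH A) (fun u => bit y u ==>
        bex (nH A) (fun h => bex (nH A) (fun h' => bex (nsets A) (fun z =>
          bit z u && link A a x' y x h' z h))))].

(** If [w] codes U(f), [w'] codes U(f') and the letter a is not at the roots of f, this is
    membership of [x] in U(f + a[f']). *)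
Definition graft_fam A a w w' x :=
  bex (nsets A) (fun x' => bit w x' &&
    bex (nsets A) (fun y => bit w' y && graft A a x' y x)).

(** The only member of U(0) is {0}, as a forest with no nonempty path is empty. The code of U(0) is
    not computed but singled out among all [w] by its digits; [cert_graft] does the same. *)
Definition cert_empty A s :=
  ball (nfams A) (fun w =>
    ball (nsets A) (fun x => bit w x == is_single A x (zeroH A)) ==> bit s w).

Definition cert_graft A s :=
  ball (nV A) (fun a =>
    ball (nfams A) (fun w => bit s w ==>
      ball (nfams A) (fun w' => bit s w' ==>
        ball (nfams A) (fun w'' =>
          ball (nsets A) (fun x => bit w'' x == graft_fam A a w w' x) ==>
          bit s w'')))).

Definition cert_good A s :=
  ball (nfams A) (fun w => bit s w ==>
    ball (nsets A) (fun x1 => bit w x1 ==>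
      ball (nsets A) (fun x2 => bit w x2 ==>
        ball (nH A) (fun h1 => is_single A x1 h1 ==>
          ball (nH A) (fun h2 => is_single A x2 h2 ==>
            ball (nV A) (fun v => actV A v (addH A h1 h2) ==
              addH A (actV A v h1) (actV A v h2))))))).

Definition decider A :=
  bex (2 ^ nfams A) (fun s => [&& cert_empty A s, cert_graft A s & cert_good A s]).

Section Computability.
Variables (k : nat) (c : seq nat -> nat).
Hypothesis Hc : computes k c.

Lemma computes_nH : computes k (fun e => nH (decode (c e))).
Proof. rewrite /decode /=; computability. Qed.

Lemma computes_nV : computes k (fun e => nV (decode (c e))).
Proof. rewrite /decode /=; computability. Qed.

Lemma computes_zeroH : computes k (fun e => zeroH (decode (c e))).
Proof. rewrite /decode /=; computability. Qed.

Lemma computes_addH a b : computes k a -> computes k b ->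
  computes k (fun e => addH (decode (c e)) (a e) (b e)).
Proof. rewrite /decode /= => Ha Hb; computability. Qed.

Lemma computes_actV a b : computes k a -> computes k b ->
  computes k (fun e => actV (decode (c e)) (a e) (b e)).
Proof. rewrite /decode /= => Ha Hb; computability. Qed.
End Computability.
#[local] Hint Resolve computes_nH computes_nV computes_zeroH computes_addH
  computes_actV : computability.

Lemma computes_nsets k c :
  computes k c -> computes k (fun e => nsets (decode (c e))).
Proof. rewrite /nsets => Hc; computability. Qed.
#[local] Hint Resolve computes_nsets : computability.

Lemma computes_nfams k c :
  computes k c -> computes k (fun e => nfams (decode (c e))).
Proof. rewrite /nfams => Hc; computability. Qed.
#[local] Hint Resolve computes_nfams : computability.

Lemma computesb_is_single k c x h :
  computes k c -> computes k x -> computes k h ->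
  computesb k (fun e => is_single (decode (c e)) (x e) (h e)).
Proof. rewrite /is_single => Hc Hx Hh; computability. Qed.
#[local] Hint Resolve computesb_is_single : computability.

Lemma computes_act_sum k c a z :
  computes k c -> computes k a -> computes k z ->
  computes k (fun e => act_sum (decode (c e)) (a e) (z e)).
Proof. rewrite /act_sum => Hc Ha Hz; computability. Qed.
#[local] Hint Resolve computes_act_sum : computability.

Lemma computesb_link k c a x' y x h' z h :
  computes k c -> computes k a -> computes k x' -> computes k y ->
  computes k x -> computes k h' -> computes k z -> computes k h ->
  computesb k (fun e =>
    link (decode (c e)) (a e) (x' e) (y e) (x e) (h' e) (z e) (h e)).
Proof. rewrite /link => *; computability. Qed.
#[local] Hint Resolve computesb_link : computability.

Lemma computesb_graft k c a x' y x :
  computes k c -> computes k a -> computes k x' -> computes k y ->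
  computes k x ->
  computesb k (fun e => graft (decode (c e)) (a e) (x' e) (y e) (x e)).
Proof. rewrite /graft => *; computability. Qed.
#[local] Hint Resolve computesb_graft : computability.

Lemma computesb_graft_fam k c a w w' x :
  computes k c -> computes k a -> computes k w -> computes k w' ->
  computes k x ->
  computesb k (fun e => graft_fam (decode (c e)) (a e) (w e) (w' e) (x e)).
Proof. rewrite /graft_fam => *; computability. Qed.
#[local] Hint Resolve computesb_graft_fam : computability.

Lemma computesb_decider k c :
  computes k c -> computesb k (fun e => decider (decode (c e))).
Proof.
rewrite /decider /cert_empty /cert_graft /cert_good => Hc; computability.
Qed.

(** * Evaluation and path sets *)

Lemma In_map T U (F : T -> U) y (l : seq T) :
  List.In y (map F l) <-> exists2 x, List.In x l & y = F x.
Proof.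
elim: l => [|x l IHl] /=; first by split=> // -[].
split=> [[<-|/IHl[z lz ->]]|[z [->|lz] y_eq]].
- by exists x => //; left.
- by exists z => //; right.
- by left.
- by right; apply/IHl; exists z.
Qed.

Lemma In_filter T (P : pred T) y (l : seq T) :
  List.In y (filter P l) <-> List.In y l /\ P y.
Proof.
elim: l => [|x l IHl] /=; first by split=> // -[].
case: ifP => Px /=; rewrite IHl; split=> [|[[xy|ly] Py]]; try tauto.
- by case=> [<-|]; tauto.
- by rewrite xy Py in Px.
Qed.

Lemma In_cat T y (l1 l2 : seq T) :
  List.In y (l1 ++ l2) <-> List.In y l1 \/ List.In y l2.
Proof. by elim: l1 => [|x l1 IHl] /=; rewrite ?IHl; tauto. Qed.

Lemma In_flatten T y (l : seq (seq T)) :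
  List.In y (flatten l) <-> exists2 s, List.In s l & List.In y s.
Proof.
elim: l => [|x l IHl] /=; first by split=> // -[].
rewrite In_cat IHl; split=> [[xy|[s ls sy]]|[s [->|ls] sy]]; auto.
- by exists x; auto.
- by exists s; auto.
- by right; exists s.
Qed.

Lemma mem_mapP (T : Type) (F : T -> nat) h (l : seq T) :
  reflect (exists2 x, List.In x l & h = F x) (h \in map F l).
Proof.
apply: (iffP idP); rewrite -In_map; elim: (map F l) => //= k s IHs.
  by rewrite inE => /orP[/eqP->|/IHs]; auto.
by rewrite inE => -[->|/IHs->]; rewrite ?eqxx ?orbT.
Qed.

Lemma In_iota z n : List.In z (iota 0 n) <-> z < n.
Proof.
have -> : (z < n) = (z \in map id (iota 0 n)) by rewrite map_id mem_iota.
by split=> [Hz|/mem_mapP[i Hi ->] //]; apply/mem_mapP; exists z.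
Qed.

Lemma tree_forest_ind S (P : tree S -> Prop) :
  (forall a f, (forall t, List.In t f -> P t) -> P (Node a f)) ->
  forall t, P t.
Proof.
move=> HP; fix IH 1 => -[a f]; apply: HP; elim: f => [|t' f IHf] t /= => [[]|].
by case=> [<-|]; [exact: IH | exact: IHf].
Qed.

Lemma all_map_lt T n (F : T -> nat) (l : seq T) :
  (forall x, List.In x l -> F x < n) -> all (gtn (n)) (map F l).
Proof.
elim: l => //= x l IHl HF; rewrite HF ?IHl //; last by left.
by move=> y ly; apply: HF; right.
Qed.

(** The laws behind the evaluation of forests, stated on data covered by [decode_code], so that they
    pass to the decoded algebra. *)
Record semilattice_action (A : ffa) : Prop := SemilatticeAction {
  zero_lt : zeroH A < nH A;
  add_lt : forall h h', h < nH A -> h' < nH A -> addH A h h' < nH A;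
  act_lt : forall v h, v < nV A -> h < nH A -> actV A v h < nH A;
  addHA : forall h1 h2 h3, h1 < nH A -> h2 < nH A -> h3 < nH A ->
    addH A h1 (addH A h2 h3) = addH A (addH A h1 h2) h3;
  add0H : forall h, h < nH A -> addH A (zeroH A) h = h;
  addHC : forall h1 h2, h1 < nH A -> h2 < nH A -> addH A h1 h2 = addH A h2 h1;
  addHH : forall h, h < nH A -> addH A h h = h
}.

(** * Finite sums in the semilattice H and values of forests *)

Definition sumH A (l : seq nat) := foldr (addH A) (zeroH A) l.

Section Sums.
Variable A : ffa.
Hypothesis HA : semilattice_action A.
Local Notation inH l := (all (gtn (nH A)) l).

Lemma sumH_lt l : inH l -> sumH A l < nH A.
Proof.
elim: l => [|h l IHl] /= => [_|/andP[lt_h /IHl]]; first exact: zero_lt.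
exact: add_lt.
Qed.

Lemma sumH_cat l1 l2 : inH l1 -> inH l2 ->
  sumH A (l1 ++ l2) = addH A (sumH A l1) (sumH A l2).
Proof.
move=> H1 H2; elim: l1 H1 => [|h l IHl] /= => [_|/andP[lt_h Hl]].
  by rewrite add0H // sumH_lt.
by rewrite IHl // addHA // sumH_lt.
Qed.

(** Read h + u = u as h <= u: then a sum is an upper bound of its entries, and by [sumH_lub] the
    least one. *)
Lemma sumH_ub l h : inH l -> h \in l -> addH A h (sumH A l) = sumH A l.
Proof.
elim: l => //= k l IHl /andP[lt_k Hl]; rewrite inE => /orP[/eqP->|hl].
  by rewrite addHA ?sumH_lt // addHH.
have lt_h : h < nH A by apply: (allP Hl).
by rewrite addHA ?sumH_lt // (addHC HA lt_h) // -addHA ?sumH_lt // IHl.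
Qed.

Lemma sumH_lub l u : inH l -> u < nH A ->
  (forall h, h \in l -> addH A h u = u) -> addH A (sumH A l) u = u.
Proof.
move=> + lt_u; elim: l => [|h l IHl] /= => [_ _|/andP[lt_h Hl] ub].
  exact: add0H.
rewrite -addHA ?sumH_lt // IHl // => [|k kl]; last by rewrite ub // inE kl orbT.
by rewrite ub // inE eqxx.
Qed.

(** Both sums are joins of the same set; antisymmetry of the order is commutativity of the
    addition. *)
Lemma eq_sumH l1 l2 : inH l1 -> inH l2 -> l1 =i l2 -> sumH A l1 = sumH A l2.
Proof.
move=> H1 H2 eq_l.
rewrite -(@sumH_lub l1 (sumH A l2)) ?sumH_lt // => [|h]; last first.
  by rewrite eq_l; apply: sumH_ub.
rewrite addHC ?sumH_lt // sumH_lub ?sumH_lt // => h.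
by rewrite -eq_l; apply: sumH_ub.
Qed.

Lemma act_sumE a z :
  act_sum A a z =
  sumH A [seq actV A a i | i <- rev (iota 0 (nH A)) & bit z i].
Proof.
rewrite /act_sum; elim: (nH A) => // n IHn.
rewrite -addn1 iotaD rev_cat /= add0n addn1 /= IHn.
by case: (bit z n).
Qed.
End Sums.

Section Evaluation.
Variables (A : ffa) (S : Type) (g : S -> nat).
Hypothesis HA : semilattice_action A.
Hypothesis Hg : forall a, g a < nV A.
Implicit Types (t : tree S) (f : forest S) (Cs : seq (forest S)).

Lemma eval_forestE f : eval_forest A g f = sumH A [seq eval_tree A g t | t <- f].
Proof. by rewrite /sumH foldr_map. Qed.

Lemma eval_node a f :
  eval_tree A g (Node a f) = actV A (g a) (eval_forest A g f).
Proof. by rewrite /=; congr actV; elim: f => //= t f ->. Qed.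

Lemma eval_tree_lt t : eval_tree A g t < nH A.
Proof.
elim/tree_forest_ind: t => a f IHf; rewrite eval_node act_lt // eval_forestE.
by apply: sumH_lt => //; apply: all_map_lt.
Qed.
#[local] Hint Resolve eval_tree_lt : core.

Lemma eval_trees_lt f : all (gtn (nH A)) [seq eval_tree A g t | t <- f].
Proof. by apply: all_map_lt. Qed.
#[local] Hint Resolve eval_trees_lt : core.

Lemma eval_forest_lt f : eval_forest A g f < nH A.
Proof. by rewrite eval_forestE sumH_lt. Qed.
#[local] Hint Resolve eval_forest_lt : core.

Lemma eval_cat f1 f2 :
  eval_forest A g (f1 ++ f2) = addH A (eval_forest A g f1) (eval_forest A g f2).
Proof. by rewrite !eval_forestE map_cat sumH_cat. Qed.

Lemma eval_seq1 t : eval_forest A g [:: t] = eval_tree A g t.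
Proof. by rewrite /eval_forest /= addHC ?add0H ?zero_lt. Qed.

Lemma eval_flatten Cs :
  eval_forest A g (flatten Cs) = sumH A [seq eval_forest A g C | C <- Cs].
Proof. by elim: Cs => //= C Cs <-; rewrite eval_cat. Qed.

End Evaluation.

Section Paths.
Variable S : Type.
Implicit Types (t : tree S) (f : forest S) (Cs : seq (forest S)).

Lemma in_pi_flatten a Cs p :
  in_pi (flatten Cs) (a :: p) <-> exists2 C, List.In C Cs & in_pi C (a :: p).
Proof.
split=> [[t /In_flatten[C CsC Ct] Ht]|[C CsC [t Ct Ht]]].
  by exists C => //; exists t.
by exists t => //; apply/In_flatten; exists C.
Qed.

(** Nonemptiness is for the empty path, which belongs even to the union of no forests. *)
Lemma in_pi_family Cs p : Cs <> [::] ->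
  (in_pi (flatten Cs) p <-> exists2 C, List.In C Cs & in_pi C p).
Proof.
case: p => [|a p] Cs0; last exact: in_pi_flatten.
by case: Cs Cs0 => // C Cs _; split=> // _; exists C => //; left.
Qed.

Lemma in_pi_cat f1 f2 p : in_pi (f1 ++ f2) p <-> in_pi f1 p \/ in_pi f2 p.
Proof.
case: p => [|a p] /=; first by tauto.
split=> [[t /In_cat[] Ht]|[] [t Ht Hp]].
- by left; exists t.
- by right; exists t.
- by exists t => //; apply/In_cat; left.
- by exists t => //; apply/In_cat; right.
Qed.
End Paths.

(** * Splitting forests and path sets at a root letter *)

Section Derivatives.
Variable S : eqType.
Implicit Types (t : tree S) (f : forest S) (Cs : seq (forest S)) (a : S).

Definition others a f := [seq t <- f | label t != a].
Definition below a f := [seq children t | t <- f & label t == a].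

Lemma same_paths_others a f1 f2 :
  same_paths f1 f2 -> same_paths (others a f1) (others a f2).
Proof.
have E f b p : in_pi (others a f) (b :: p) <-> b != a /\ in_pi f (b :: p).
  split=> [[t /In_filter[ft lt] [<- Hp]]|[ba [t ft [lt Hp]]]].
    by split=> //; exists t.
  by exists t => //; apply/In_filter; rewrite lt.
by move=> eq_f [|b p] //; rewrite !E (eq_f (b :: p)).
Qed.

(** Apart from the empty path, which every forest has, the paths of the union of [below a f] form
    the left quotient by a of the paths of [f]. *)
Lemma same_paths_below a f1 f2 :
  same_paths f1 f2 -> same_paths (flatten (below a f1)) (flatten (below a f2)).
Proof.
have E f b p : in_pi (flatten (below a f)) (b :: p) <-> in_pi f (a :: b :: p).
  rewrite in_pi_flatten; split=> [[C /In_map[t]]|[t ft [lt Hp]]].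
    by move=> /In_filter[ft /eqP lt] -> Hp; exists t.
  exists (children t) => //; apply/In_map; exists t => //.
  by apply/In_filter; rewrite lt eqxx.
by move=> eq_f [|b p] //; rewrite !E (eq_f (a :: b :: p)).
Qed.

End Derivatives.

(** * Soundness *)

(* [x] codes the set of values taken on the family [Cs]. *)
Definition represents S (A : ffa) (g : S -> nat) x (Cs : seq (forest S)) :=
  forall i, i < nH A ->
    (bit x i <-> exists2 C, List.In C Cs & eval_forest A g C = i).

Lemma representation_exists S A (g : S -> nat) Cs :
  exists2 x, x < nsets A & represents A g x Cs.
Proof. exact: bits_exist. Qed.

Section Representation.
Variables (A : ffa) (S : Type) (g : S -> nat).
Hypothesis HA : semilattice_action A.
Hypothesis Hg : forall a, g a < nV A.
Implicit Types (t : tree S) (f : forest S) (Cs : seq (forest S)).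

Lemma eq_eval_forest f1 f2 :
  (forall t, List.In t f1 <-> List.In t f2) ->
  eval_forest A g f1 = eval_forest A g f2.
Proof.
move=> eq_f; rewrite !eval_forestE.
apply: (eq_sumH HA); rewrite ?eval_trees_lt // => h.
by apply/mem_mapP/mem_mapP => -[t ft ->]; exists t => //; apply/eq_f.
Qed.

Lemma represents_mem x Cs C :
  represents A g x Cs -> List.In C Cs -> bit x (eval_forest A g C).
Proof. by move=> Hx CsC; apply/(Hx _ (eval_forest_lt HA Hg C)); exists C. Qed.

Lemma represents_act_sum a z Ds : represents A g z Ds ->
  act_sum A (g a) z = eval_forest A g [seq Node a D | D <- Ds].
Proof.
move=> Hz; rewrite act_sumE eval_forestE; apply: (eq_sumH HA).
- apply/allP => h /mapP[i]; rewrite mem_filter mem_rev mem_iota => /and3P[_ _ lt_i].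
  by move=> ->; apply: act_lt.
- exact: eval_trees_lt.
move=> h; apply/mapP/mem_mapP => [[i]|[t /In_map[D DsD ->] ->]].
  rewrite mem_filter mem_rev mem_iota => /and3P[z_i _ lt_i] ->.
  have [D DsD <-] := (Hz i lt_i).1 z_i.
  by exists (Node a D); [apply/In_map; exists D | rewrite eval_node].
exists (eval_forest A g D); last by rewrite eval_node.
have lt_D : eval_forest A g D < nH A by apply: eval_forest_lt.
rewrite mem_filter mem_rev mem_iota; apply/and3P; split=> //.
exact: represents_mem Hz DsD.
Qed.

(** All members have the value [h], hence by idempotence so does their union. Thus a singleton in
    U(f) comes from one forest with the paths of f. *)
Lemma represents_single x Cs h :
  h < nH A -> Cs <> [::] -> represents A g x Cs -> is_single A x h ->
  eval_forest A g (flatten Cs) = h.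
Proof.
move=> lt_h Cs0 Hx /ballP Hs.
have evC C : List.In C Cs -> eval_forest A g C = h.
  move=> CsC; have lt_C : eval_forest A g C < nH A by apply: eval_forest_lt.
  by apply/eqP; rewrite -(eqP (Hs _ lt_C)); exact: represents_mem Hx CsC.
have sum1 : sumH A [:: h] = h by rewrite /= addHC ?add0H ?zero_lt.
rewrite eval_flatten // -[RHS]sum1; apply: (eq_sumH HA) => [||k].
- by apply: all_map_lt => C _; apply: eval_forest_lt.
- by rewrite /= lt_h.
rewrite inE; apply/mem_mapP/eqP => [[C /evC -> //]|->].
by case: Cs Cs0 {Hx} evC => // C Cs _ evC; exists C; [left | rewrite evC //; left].
Qed.
End Representation.

Fixpoint tree_size S (t : tree S) : nat :=
  let: Node _ f := t in (sumn [seq tree_size u | u <- f]).+1.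
Definition forest_size S (f : forest S) := sumn [seq tree_size t | t <- f].

(** The measure for [cert_contains]: the count is the number of removed roots, so both parts are
    smaller than [f] once a labels a root. *)
Lemma forest_size_split (S : eqType) (a : S) f :
  forest_size (others a f) + forest_size (flatten (below a f)) +
    count (fun t => label t == a) f = forest_size f.
Proof.
rewrite /forest_size; elim: f => //= -[b c] f IHf; rewrite /= -IHf.
by rewrite /below /=; case: eqP => _ /=; rewrite ?map_cat ?sumn_cat; lia.
Qed.

Section Soundness.
Variables (A : ffa) (S : eqType) (g : S -> nat) (s : nat).
Hypothesis HA : semilattice_action A.
Hypothesis Hg : forall a, g a < nV A.
Implicit Types (t : tree S) (f : forest S) (Cs : seq (forest S)).

Lemma eval_split a f :
  eval_forest A g f = addH A (eval_forest A g (others a f))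
    (eval_forest A g [seq Node a D | D <- below a f]).
Proof.
rewrite -eval_cat //; apply: eq_eval_forest => // -[b D].
rewrite In_cat In_filter In_map /=; split=> [ft|[[] //|[E /In_map[t]]]].
  case: (eqVneq b a) => [<-|ba]; [right|by left].
  exists D => //; apply/In_map; exists (Node b D) => //.
  by apply/In_filter; rewrite /= eqxx.
by case: t => c E' /In_filter[ft /= /eqP <-] -> [-> ->].
Qed.

(** A member C consists of [others a C] and the trees a[D] for D in [below a C]; the witness [z] is
    the value set of the latter family. *)
Lemma link_family a Cs x x' y C :
  represents A g x Cs -> represents A g x' (map (others a) Cs) ->
  represents A g y (below a (flatten Cs)) -> List.In C Cs ->
  exists2 z, z < nsets A &
    represents A g z (below a C) /\
    link A (g a) x' y x (eval_forest A g (others a C)) z (eval_forest A g C).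
Proof.
move=> Hx Hx' Hy CsC; have [z lt_z Hz] := representation_exists A g (below a C).
exists z => //; split=> //; apply/and4P; split.
- exact: represents_mem Hx CsC.
- by apply: (represents_mem HA Hg Hx'); apply/In_map; exists C.
- apply/ballP => i lt_i; apply/implyP => /(Hz i lt_i)[E /In_map[t]].
  move=> /In_filter[Ct la] -> <-; apply: (represents_mem HA Hg Hy).
  apply/In_map; exists t => //; apply/In_filter; split=> //.
  by apply/In_flatten; exists C.
by rewrite (represents_act_sum HA Hg a Hz) -eval_split.
Qed.

Lemma graft_family a Cs x x' y :
  represents A g x Cs -> represents A g x' (map (others a) Cs) ->
  represents A g y (below a (flatten Cs)) ->
  graft A (g a) x' y x.
Proof.
move=> Hx Hx' Hy; have links C := link_family (C := C) Hx Hx' Hy.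
apply/and3P; split; apply/ballP => i lt_i; apply/implyP.
- move=> /(Hx i lt_i)[C CsC <-]; have [z lt_z [_ Hl]] := links C CsC.
  apply/bexP; exists (eval_forest A g (others a C)); first exact: eval_forest_lt.
  by apply/bexP; exists z.
- move=> /(Hx' i lt_i)[E /In_map[C CsC ->] <-]; have [z lt_z [_ Hl]] := links C CsC.
  apply/bexP; exists (eval_forest A g C); first exact: eval_forest_lt.
  by apply/bexP; exists z.
move=> /(Hy i lt_i)[D /In_map[t /In_filter[/In_flatten[C CsC Ct] la] ->] <-].
have [z lt_z [Hz Hl]] := links C CsC.
apply/bexP; exists (eval_forest A g C); first exact: eval_forest_lt.
apply/bexP; exists (eval_forest A g (others a C)); first exact: eval_forest_lt.
apply/bexP; exists z => //; rewrite Hl andbT; apply: (represents_mem HA Hg Hz).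
by apply/In_map; exists t => //; apply/In_filter.
Qed.

Hypothesis s_empty : cert_empty A s.
Hypothesis s_graft : cert_graft A s.

(** Some member of [s] contains U(f), by induction on the size of [f]. Let a label the first root.
    Merging all trees with root a keeps the paths, so [f] may be viewed as [others a f] plus one
    tree a[f'], f' being the union of [below a f], and [w] is grafted from the sets found for these
    two. A family with the paths of [f] splits in the same way, member by member. *)
Lemma cert_contains f :
  exists w, [/\ w < nfams A, bit s w & forall Cs x,
    Cs <> [::] -> same_paths (flatten Cs) f -> x < nsets A ->
    represents A g x Cs -> bit w x].
Proof.
have [n le_n] := ubnP (forest_size f); elim: n f le_n => // n IHn f lt_n.
case: f lt_n => [|t f0] lt_n.
  have [w lt_w Hw] := bits_exist (nsets A) (fun x => is_single A x (zeroH A)).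
  exists w; split=> //.
    move/ballP/(_ w lt_w)/implyP: s_empty; apply; apply/ballP => x lt_x.
    by apply/eqP; apply/idP/idP => /(Hw x lt_x).
  move=> Cs x Cs0 Cs_paths lt_x Hx; apply/(Hw x lt_x); apply/ballP => i lt_i.
  have Cs_nil C : List.In C Cs -> C = [::].
    case: C => // t C CsC.
    have /(Cs_paths [:: label t])[] // : in_pi (flatten Cs) [:: label t].
    by exists t => //; apply/In_flatten; exists (t :: C) => //; left.
  apply/eqP; apply/idP/eqP => [/(Hx i lt_i)[C /Cs_nil -> <- //]|->].
  case: Cs Cs0 Hx Cs_nil {Cs_paths} => // C Cs _ Hx Cs_nil.
  have CsC : List.In C (C :: Cs) by left.
  by have := represents_mem HA Hg Hx CsC; rewrite (Cs_nil C CsC).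
set f := t :: f0 in lt_n *; set a := label t.
have sz := forest_size_split a f.
have sz1 : 0 < count (fun t => label t == a) f by rewrite /= eqxx.
have [w0 [lt_w0 s_w0 Hw0]] : _ := IHn (others a f) ltac:(lia).
have [wa [lt_wa s_wa Hwa]] : _ := IHn (flatten (below a f)) ltac:(lia).
have [w lt_w Hw] := bits_exist (nsets A) (fun x => graft_fam A (g a) w0 wa x).
exists w; split=> //.
  move/ballP/(_ _ (Hg a))/ballP/(_ _ lt_w0)/implyP/(_ s_w0): s_graft.
  move=> /ballP/(_ _ lt_wa)/implyP/(_ s_wa)/ballP/(_ _ lt_w)/implyP; apply.
  by apply/ballP => x lt_x; apply/eqP; apply/idP/idP => /(Hw x lt_x).
move=> Cs x Cs0 Cs_paths lt_x Hx; apply/(Hw x lt_x).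
have [x' lt_x' Hx'] := representation_exists A g (map (others a) Cs).
have [y lt_y Hy] := representation_exists A g (below a (flatten Cs)).
apply/bexP; exists x' => //; apply/andP; split.
  apply: (Hw0 _ _ _ _ lt_x' Hx'); first by case: (Cs) Cs0.
  rewrite /others -filter_flatten; exact: same_paths_others.
apply/bexP; exists y => //; rewrite (graft_family Hx Hx' Hy) andbT.
apply: (Hwa _ _ _ _ lt_y Hy); last exact: same_paths_below.
(* The family below a is nonempty, because [Cs] shares the path a with [f]. *)
have /Cs_paths[u Csu [la _]] : in_pi f [:: a] by exists t => //; left.
suff /In_map : exists2 t, List.In t [seq t <- flatten Cs | label t == a] &
    children u = children t by rewrite -/(below _ _); case: (below _ _).
by exists u => //; apply/In_filter; rewrite la eqxx.
Qed.

(** The families with the single members [f1] and [f2] have singleton value sets, and both sets lie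
    in the member of [s] found for [f2]. *)
Lemma cert_distributive f1 f2 v :
  cert_good A s -> same_paths f1 f2 -> v < nV A ->
  actV A v (addH A (eval_forest A g f1) (eval_forest A g f2)) =
  addH A (actV A v (eval_forest A g f1)) (actV A v (eval_forest A g f2)).
Proof.
move=> s_good eq_f lt_v; have [w [lt_w s_w Hw]] := cert_contains f2.
have single f : same_paths f f2 ->
    exists2 x, x < nsets A & bit w x /\ is_single A x (eval_forest A g f).
  move=> eq_ff2; have [x lt_x Hx] := representation_exists A g [:: f].
  exists x => //; split; first by apply: (Hw [:: f]); rewrite //= cats0.
  apply/ballP => i lt_i; apply/eqP; apply/idP/eqP => [/(Hx i lt_i)[E [<-|//] //]|->].
  by apply: (represents_mem HA Hg Hx); left.
have [x1 lt_x1 [w_x1 s_x1]] := single f1 eq_f.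
have [x2 lt_x2 [w_x2 s_x2]] : _ := single f2 (fun p => iff_refl _).
have lt_f f : eval_forest A g f < nH A by apply: eval_forest_lt.
move/ballP/(_ _ lt_w)/implyP/(_ s_w)/ballP/(_ _ lt_x1)/implyP: s_good.
move/(_ w_x1)/ballP/(_ _ lt_x2)/implyP/(_ w_x2)/ballP/(_ _ (lt_f f1))/implyP.
by move/(_ s_x1)/ballP/(_ _ (lt_f f2))/implyP/(_ s_x2)/ballP/(_ _ lt_v)/eqP.
Qed.
End Soundness.

(** * Completeness *)

Lemma represents_sub S A (g : S -> nat) y z Ds :
  represents A g y Ds -> (forall i, i < nH A -> bit z i -> bit y i) ->
  represents A g z [seq D <- Ds | bit z (eval_forest A g D)].
Proof.
move=> Hy sub i lt_i; split=> [z_i|[D /In_filter[_ +] <-] //].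
have [D DsD ev_D] := (Hy i lt_i).1 (sub i lt_i z_i).
by exists D => //; apply/In_filter; rewrite ev_D.
Qed.

(** * Realizing a graft by a family of forests *)

Section Grafting.
Variables (A : ffa) (S : Type) (g : S -> nat) (a : S).
Hypothesis HA : semilattice_action A.
Hypothesis Hg : forall b, g b < nV A.
Variables (Cs Ds : seq (forest S)) (f f' : forest S) (x x' y : nat).
Hypothesis Cs0 : Cs <> [::].
Hypothesis Ds0 : Ds <> [::].
Hypothesis Cs_paths : same_paths (flatten Cs) f.
Hypothesis Ds_paths : same_paths (flatten Ds) f'.
Hypothesis Hx' : represents A g x' Cs.
Hypothesis Hy : represents A g y Ds.
Hypothesis Hgraft : graft A (g a) x' y x.

(** The forest that [link] describes, with [C] as the member of value [h']. *)
Let hang C z :=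
  C ++ [seq Node a D | D <- Ds & bit z (eval_forest A g D)].

Let hangs C z :=
  ball (nH A) (fun i => bit z i ==> bit y i) &&
  bit x (eval_forest A g (hang C z)).

(** All hung forests with [z] inside [y] and value in [x]. The clauses of [graft] then say in turn
    that every value in [x] is attained, that every C is used and that every D is used. *)
Let Es := flatten [seq [seq hang C z | z <- iota 0 (nsets A) & hangs C z]
                  | C <- Cs].

Let Es_hang E : List.In E Es <->
  exists C z, [/\ List.In C Cs, z < nsets A, hangs C z & E = hang C z].
Proof.
rewrite In_flatten; split=> [[s /In_map[C CsC ->]]|[C [z [CsC lt_z Hz ->]]]].
  by move=> /In_map[z /In_filter[/In_iota lt_z Hz] ->]; exists C, z.
exists [seq hang C z | z <- iota 0 (nsets A) & hangs C z].
  by apply/In_map; exists C.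
by apply/In_map; exists z => //; apply/In_filter; rewrite In_iota.
Qed.

Let link_hang C z h : List.In C Cs -> z < nsets A ->
  link A (g a) x' y x (eval_forest A g C) z h ->
  List.In (hang C z) Es /\ eval_forest A g (hang C z) = h.
Proof.
move=> CsC lt_z /and4P[x_h _ sub /eqP h_eq].
have ev_h : eval_forest A g (hang C z) = h.
  rewrite eval_cat // h_eq; congr addH.
  apply/esym/(represents_act_sum HA Hg); apply: represents_sub Hy _ => i lt_i.
  by apply/implyP; apply: (ballP _ _ sub).
by split=> //; apply/Es_hang; exists C, z; rewrite /hangs sub ev_h.
Qed.

Let hang_left C : List.In C Cs -> exists z, List.In (hang C z) Es.
Proof.
move=> CsC; have lt_C := eval_forest_lt HA Hg C.
have /and3P[_ /ballP/(_ _ lt_C)/implyP/(_ (represents_mem HA Hg Hx' CsC)) + _] :=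
  Hgraft.
move=> /bexP[h lt_h /bexP[z lt_z /(link_hang CsC lt_z)[EsE _]]].
by exists z.
Qed.

Let hang_right D : List.In D Ds ->
  exists C z, List.In (hang C z) Es /\ bit z (eval_forest A g D).
Proof.
move=> DsD; have lt_D := eval_forest_lt HA Hg D.
have /and3P[_ _ /ballP/(_ _ lt_D)/implyP/(_ (represents_mem HA Hg Hy DsD))] :=
  Hgraft.
move=> /bexP[h lt_h /bexP[h' lt_h' /bexP[z lt_z /andP[z_D Hl]]]].
have /and4P[_ /(Hx' lt_h')[C CsC ev_C] _ _] := Hl.
by rewrite -ev_C in Hl; have [] := link_hang CsC lt_z Hl; exists C, z.
Qed.

(** Each path of a member of [Es] comes from some C or from some a[D], and none is lost since every
    C and every D is used. The letter a may also label roots of [f]. *)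
Lemma graft_realized :
  exists Es, [/\ Es <> [::], same_paths (flatten Es) (Node a f' :: f) &
    represents A g x Es].
Proof.
have Es0 : Es <> [::].
  move=> Es_nil; case: (Cs) Cs0 hang_left => // C Cs' _ /(_ C)[].
    by left.
  by move=> z; rewrite Es_nil.
exists Es; split=> // [p|i lt_i].
  rewrite in_pi_family //; case: p => [|b p].
    by split=> // _; case: (Es) Es0 => // E Es' _; exists E => //; left.
  split=> [[_ /Es_hang[C [z [CsC _ _ ->]]]]|[t [<-|ft] [lt Hp]]].
  - case/in_pi_cat => [Hp|[_ /In_map[D /In_filter[DsD _] ->] [/= <- Hp]]].
      have [t ft Ht] : in_pi f (b :: p).
        by apply/Cs_paths/in_pi_flatten; exists C.
      by exists t => //; right.
    exists (Node a f'); [by left | split=> //=].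
    by apply/Ds_paths/in_pi_family => //; exists D.
  - have /Ds_paths/(in_pi_family _ Ds0)[D DsD HD] : in_pi f' p := Hp.
    have [C [z [EsE z_D]]] := hang_right DsD; exists (hang C z) => //.
    apply/in_pi_cat; right; exists (Node a D) => //.
    by apply/In_map; exists D => //; apply/In_filter.
  have : in_pi f (b :: p) by exists t.
  move=> /Cs_paths/in_pi_flatten[C CsC HC]; have [z EsE] := hang_left CsC.
  by exists (hang C z) => //; apply/in_pi_cat; left.
split=> [x_i|[_ /Es_hang[C [z [_ _ /andP[_ x_E] ->]]] <-] //].
have /and3P[/ballP/(_ _ lt_i)/implyP/(_ x_i) + _ _] := Hgraft.
move=> /bexP[h' lt_h' /bexP[z lt_z Hl]].
have /and4P[_ /(Hx' lt_h')[C CsC ev_C] _ _] := Hl.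
by rewrite -ev_C in Hl; have [EsE ev_E] := link_hang CsC lt_z Hl; exists (hang C z).
Qed.
End Grafting.

Section Completeness.
Variable A : ffa.
Hypothesis HA : semilattice_action A.
Local Notation letter := 'I_(nV A).
Local Notation val := (@nat_of_ord (nV A)).

(** [w] codes a subset of some U(f); equality would fail when grafting repeats a root letter. With V
    itself as alphabet, each [a] of [cert_graft] is the value of a letter. *)
Let realized w := exists f : forest letter, forall x, x < nsets A -> bit w x ->
  exists Cs, [/\ Cs <> [::], same_paths (flatten Cs) f & represents A val x Cs].

Lemma decider_complete :
  (forall f1 f2 : forest letter, same_paths f1 f2 -> forall v, v < nV A ->
    actV A v (addH A (eval_forest A val f1) (eval_forest A val f2)) =
    addH A (actV A v (eval_forest A val f1)) (actV A v (eval_forest A val f2))) ->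
  decider A.
Proof.
have Hval (a : letter) : val a < nV A by apply: ltn_ord.
(* The certificate is the set of all realized [w]. *)
move=> distr; have [s lt_s Hs] := bits_exist (nfams A) realized.
apply/bexP; exists s => //; apply/and3P; split.
- apply/ballP => w lt_w; apply/implyP => /ballP w_single; apply/(Hs w lt_w).
  exists [::] => x lt_x; rewrite (eqP (w_single x lt_x)) => /ballP x_single.
  exists [:: [::]]; split=> // i lt_i; rewrite (eqP (x_single i lt_i)).
  by split=> [/eqP ->|[_ [<-|//] <-] //]; exists [::] => //; left.
- apply/ballP => a lt_a; apply/ballP => w lt_w; apply/implyP => /(Hs w lt_w)[f Hf].
  apply/ballP => w' lt_w'; apply/implyP => /(Hs w' lt_w')[f' Hf'].
  apply/ballP => w'' lt_w''; apply/implyP => /ballP w''_graft.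
  apply/(Hs w'' lt_w''); exists (Node (Ordinal lt_a) f' :: f) => x lt_x.
  rewrite (eqP (w''_graft x lt_x)) => /bexP[x' lt_x' /andP[w_x' /bexP[y lt_y]]].
  case/andP=> w'_y Hgraft.
  have [Cs [Cs0 Cs_paths Hx']] := Hf x' lt_x' w_x'.
  have [Ds [Ds0 Ds_paths Hy]] := Hf' y lt_y w'_y.
  exact: (@graft_realized _ _ _ (Ordinal lt_a) HA Hval _ _ _ _ _ _ _
    Cs0 Ds0 Cs_paths Ds_paths Hx' Hy Hgraft).
apply/ballP => w lt_w; apply/implyP => /(Hs w lt_w)[f Hf].
apply/ballP => x1 lt_x1; apply/implyP => /(Hf x1 lt_x1)[Cs1 [Cs10 paths1 Hx1]].
apply/ballP => x2 lt_x2; apply/implyP => /(Hf x2 lt_x2)[Cs2 [Cs20 paths2 Hx2]].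
apply/ballP => h1 lt_h1; apply/implyP => single1.
apply/ballP => h2 lt_h2; apply/implyP => single2.
apply/ballP => v lt_v; apply/eqP.
rewrite -(represents_single HA Hval lt_h1 Cs10 Hx1 single1).
rewrite -(represents_single HA Hval lt_h2 Cs20 Hx2 single2).
by apply: distr => // p; rewrite paths1 paths2.
Qed.
End Completeness.

(** * Contexts, decoding and correctness of the program *)

Lemma decider_sound A (S : eqType) (g : S -> nat) (f1 f2 : forest S) v :
  semilattice_action A -> (forall a, g a < nV A) -> decider A ->
  same_paths f1 f2 -> v < nV A ->
  actV A v (addH A (eval_forest A g f1) (eval_forest A g f2)) =
  addH A (actV A v (eval_forest A g f1)) (actV A v (eval_forest A g f2)).
Proof.
move=> HA Hg /bexP[s _ /and3P[s_empty s_graft s_good]].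
exact: (cert_distributive HA Hg s_empty s_graft s_good).
Qed.

Lemma forest_algebra_semilattice A : is_forest_algebra A -> semilattice_action A.
Proof.
case=> z_lt [_ [a_lt [_ [v_lt [aA [a0 [aC [aI _]]]]]]]].
by split=> // h lt_h; have [] := a0 h lt_h.
Qed.

(** The context component of the morphism: the hole becomes 1, adding a forest of value h becomes
    multiplication by I_h, and a node multiplies by its letter. *)
Lemma eval_context A S (g : S -> nat) (c : context S) :
  is_forest_algebra A -> (forall a, g a < nV A) ->
  exists2 u, u < nV A &
    forall f, eval_forest A g (subst c f) = actV A u (eval_forest A g f).
Proof.
move=> FA Hg; have HA := forest_algebra_semilattice FA.
have lt_f f := @eval_forest_lt _ _ _ HA Hg f.
have [_ [one_lt [_ [mul_lt [v_lt]]]]] := FA.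
case=> _ [_ [_ [_ [_ [_ [actM [act1 [_ [ins _]]]]]]]]].
elim: c => [|f0 c [u lt_u Hu]|a c [u lt_u Hu]].
- by exists (oneV A) => // f; rewrite act1.
- have [I lt_I HI] := ins _ (lt_f f0).
  exists (mulV A I u); first exact: mul_lt.
  by move=> f; rewrite [subst _ _]/= eval_cat // Hu actM // HI // v_lt.
exists (mulV A (g a) u) => [|f]; first by apply: mul_lt.
by rewrite [subst _ _]/= eval_seq1 // eval_node Hu actM.
Qed.

Section Transfer.
Variables A B : ffa.
Hypothesis HA : semilattice_action A.
Hypothesis eq_nH : nH B = nH A.
Hypothesis eq_nV : nV B = nV A.
Hypothesis eq_zeroH : zeroH B = zeroH A.
Hypothesis eq_addH : forall i j, i < nH A -> j < nH A -> addH B i j = addH A i j.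
Hypothesis eq_actV : forall v h, v < nV A -> h < nH A -> actV B v h = actV A v h.

Lemma transfer_semilattice : semilattice_action B.
Proof.
case: HA => z_lt a_lt v_lt aA a0 aC aI.
split; rewrite ?eq_nH ?eq_nV ?eq_zeroH // => *; rewrite ?eq_addH ?eq_actV //.
all: by [auto | rewrite eq_addH ?a_lt; auto].
Qed.

Lemma transfer_eval S (g : S -> nat) f :
  (forall a, g a < nV A) -> eval_forest B g f = eval_forest A g f.
Proof.
move=> Hg.
have ev_forest f0 : (forall t, List.In t f0 -> eval_tree B g t = eval_tree A g t) ->
    eval_forest B g f0 = eval_forest A g f0.
  elim: f0 => [|t f0 IHf] ev_f0 /=; first exact: eq_zeroH.
  rewrite IHf => [|u f0u]; last by apply: ev_f0; right.
  by rewrite ev_f0 ?eq_addH ?eval_tree_lt ?eval_forest_lt //; left.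
apply: (ev_forest) => t _; elim/tree_forest_ind: t => a f0 IHf.
by rewrite !eval_node ev_forest // eq_actV ?eval_forest_lt.
Qed.
End Transfer.

Lemma decider_correct A : is_forest_algebra A ->
  two_distributive A <-> decider (decode (ffa_code A)).
Proof.
move=> FA; have HA := forest_algebra_semilattice FA.
have [eq_nH eq_nV eq_z eq_add eq_act] := decode_code A.
move: (decode _) eq_nH eq_nV eq_z eq_add eq_act => B eq_nH eq_nV eq_z eq_add eq_act.
have HB := transfer_semilattice HA eq_nH eq_nV eq_z eq_add eq_act.
have ev S (g : S -> nat) f Hg :=
  @transfer_eval A B HA eq_z eq_add eq_act S g f Hg.
split=> [distr|decB S g Hg c f1 f2 eq_f].
  apply: decider_complete => // f1 f2 eq_f v lt_v.
  have Hg (a : 'I_(nV B)) : a < nV A by rewrite -eq_nV.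
  have lt_f f := eval_forest_lt HA Hg f.
  rewrite eq_nV in lt_v; rewrite !ev // eq_add // !eq_act ?add_lt //.
  rewrite eq_add ?act_lt //.
  have lt_v' : v < nV B by rewrite eq_nV.
  (* Over the alphabet V, the element [v] is the action of the one-node context with label [v]. *)
  have := distr _ _ Hg (CNode (Ordinal lt_v') Hole) f1 f2 eq_f.
  by rewrite ![subst _ _]/= eval_cat // !eval_seq1 // !eval_node eval_cat.
have [u lt_u Hu] := eval_context c FA Hg.
rewrite !eval_cat // !Hu eval_cat //.
have lt_f f := eval_forest_lt HA Hg f.
have lt_uB : u < nV B by rewrite eq_nV.
have HgB a : g a < nV B by rewrite eq_nV.
have := decider_sound HB HgB decB eq_f lt_uB.
by rewrite !ev // eq_add // !eq_act ?add_lt // eq_add ?act_lt.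
Qed.

Theorem mainTheorem2 :
  exists p : prog, forall A : ffa, is_forest_algebra A ->
    (two_distributive A -> ev p [:: ffa_code A] 1) /\
    (~ two_distributive A -> ev p [:: ffa_code A] 0).
Proof.
have [p Hp] : computesb 1 (fun e => decider (decode (head 0 e))).
  by apply: computesb_decider; apply: computes_head; apply: env_map_id.
exists p => A FA; have := Hp [:: ffa_code A] erefl.
rewrite [head _ _]/=.
have dec := decider_correct FA.
by case: (decider _) dec => -[distr_dec dec_distr]; split=> // distr;
  [case: distr; apply: dec_distr | have := distr_dec distr].
Qed.
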